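(* There exist positive integers $g,h$ and a monic linear pencil $L$ in $g+h$ variables such that the free projection $\pi(\mathcal D_L)$ (a graded set in $g$ variables) is neither (i) the principal component of a free open semi-algebraic set, nor (ii) the principal component of a graded set of the form $\bigcup_{k=1}^t\bigcap_{j=1}^{s_k}\mathfrak I_{p_{k,j}}$ with $\{p_{k,j}\}$ a finite collection of symmetric matrix-valued free polynomials with each $p_{k,j}(0)$ invertible. In particular, there exist convex free basic open semi-algebraic sets whose free projections are not free open semi-algebraic.
   Context: For a positive integer $g$, $\mathcal P$ denotes the free algebra of polynomials with real coefficients in freely noncommuting variables $x=(x_1,\dots,x_g)$, and $\mathcal P^{\delta\times\delta}$ the $\delta\times\delta$ matrices over $\mathcal P$. Write $p\in\mathcal P^{\delta\times\delta}$ as a finite sum $p=\sum_w p_w w$ over words $w$ with real $\delta\times\delta$ matrices $p_w$. The involution is $p^T=\sum_w p_w^T w^T$, where $w^T$ is the reversed word; $p$ is symmetric if $p^T=p$. $\mathbb S_n(\mathbb R^g)$ is the set of $g$-tuples $X$ of real symmetric $n\times n$ matrices; $p(X)=\sum_w p_w\otimes w(X)$, where $w(X)=X_{j_1}\cdots X_{j_k}$ for $w=x_{j_1}\cdots x_{j_k}$ and $\emptyset(X)=I_n$; $p(0)=p_\emptyset$. A graded set (in $g$ variables) is a sequence $\mathcal S=(\mathcal S(n))_{n\ge1}$ with $\mathcal S(n)\subset\mathbb S_n(\mathbb R^g)$; equality, inclusion, unions and intersections are termwise. Its principal component $pc[\mathcal S]$ is the graded set whose $n$-th term is the connected component of $0$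 in $\mathcal S(n)$. It is convex if each $\mathcal S(n)$ is convex. For symmetric matrix-valued $p$ with $p(0)$ invertible, $\mathfrak I_p(n)=\{X\in\mathbb S_n(\mathbb R^g):p(X)\text{ is invertible}\}$, $\mathfrak I_p=(\mathfrak I_p(n))_n$ and $\mathcal D_p=pc[\mathfrak I_p]$. A free basic open semi-algebraic set (containing $0$) is a graded set $\bigcap_j\mathcal D_{p_j}$ for a finite set of symmetric matrix-valued polynomials $p_j$ with $p_j(0)$ invertible. A free open semi-algebraic set (containing $0$) is a finite union of free basic open semi-algebraic sets. A monic linear pencil of size $\ell$ in $g+h$ variables is $L=I_\ell+\sum_{j=1}^{g+h}A_jx_j$ with $A_j$ real symmetric $\ell\times\ell$ matrices; $\mathcal D_L(n)=\{Z\in\mathbb S_n(\mathbb R^{g+h}):L(Z)\succ0\}$. For a graded set $\mathcal D$ with $\mathcal D(n)\subset\mathbb S_n(\mathbb R^{g+h})$, its free projection is the graded set $\pi(\mathcal D)$ with $\pi(\mathcal D)(n)=\{X\in\mathbb S_n(\mathbb R^g):\text{there is }Y\in\mathbb S_n(\mathbb R^h)\text{ with }(X,Y)\in\mathcal D(n)\}$. *)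

(* Defs.v *)
From mathcomp Require Import all_boot all_order all_algebra finmap.
From mathcomp Require Import all_classical all_reals topology convex normedtype.
(* The notations of monalg are incompatible with those of MathComp-Analysis. *)
From mathcomp Require Import -(notations) monalg.
From mathcomp Require Import mxtens.

Set Implicit Arguments.
Unset Strict Implicit.
Unset Printing Implicit Defensive.

Import Order.TTheory GRing.Theory Num.Theory.
Import numFieldNormedType.Exports.
(* 'I_g -> 'M[R]_n carries the product topology. *)
Import ArrowAsProduct.

Local Open Scope classical_set_scope.
Local Open Scope ring_scope.

Section FreePolynomials.
Variables (R : realType) (g : nat).

Definition word : choiceType := fmonom 'I_g.

Definition freepoly : lalgType R := malg word R.

Definition fvar (j : 'I_g) : freepoly := mkmalgU (fmu j) 1.

Definition rev_word (w : word) : word := FMonom (rev w).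

Definition invol (f : freepoly) : freepoly :=
  \sum_(w <- msupp f) mkmalgU (rev_word w) (mcoeff w f).

(* The entry (a, b) of p^T = \sum_w p_w^T w^T is the involution of the entry
   (b, a) of p. *)
Definition mxinvol d (p : 'M[freepoly]_d) : 'M[freepoly]_d :=
  (map_mx invol p)^T.

(* The real matrix p_w in p = \sum_w p_w w. *)
Definition mxcoef d (p : 'M[freepoly]_d) (w : word) : 'M[R]_d :=
  map_mx (mcoeff w) p.

(* A finite set of words containing all those w such that p_w != 0. *)
Definition mxsupp d (p : 'M[freepoly]_d) : {fset word} :=
  \big[fsetU/fset0]_(a < d) \big[fsetU/fset0]_(b < d) msupp (p a b).

Definition word_eval n (w : word) (X : 'I_g -> 'M[R]_n) : 'M[R]_n :=
  \prod_(j <- (w : seq 'I_g)) X j.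

Definition mxeval d (p : 'M[freepoly]_d) n (X : 'I_g -> 'M[R]_n) :
    'M[R]_(d * n) :=
  \sum_(w <- mxsupp p) (mxcoef p w *t word_eval w X).

Definition mxeval0 d (p : 'M[freepoly]_d) : 'M[R]_d := mxcoef p (fmone 'I_g).

(* Symmetric matrix polynomials p, of arbitrary positive size, such that p(0)
   is invertible. *)
Record sympoly := SymPoly {
  sp_size : nat;
  sp_mx :> 'M[freepoly]_sp_size;
  sp_size_gt0 : (0 < sp_size)%N;
  sp_sym : mxinvol sp_mx = sp_mx;
  sp_unit0 : mxeval0 sp_mx \in unitmx
}.

Definition pencil l (A : 'I_g -> 'M[R]_l) : 'M[freepoly]_l :=
  1%:M + \sum_(j < g) map_mx (fun c : R => c *: fvar j) (A j).

End FreePolynomials.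

Definition symtuple (R : realType) g n : set ('I_g -> 'M[R]_n) :=
  [set X | forall j, (X j)^T = X j].

(* The term at n = 0 is irrelevant: equality and convexity only look at
   positive n. *)
Definition gset (R : realType) (g : nat) := forall n, set ('I_g -> 'M[R]_n).

Section GradedSets.
Variables (R : realType) (g : nat).

Definition eq_gset (S T : gset R g) := forall n, (0 < n)%N -> S n = T n.

Definition convex_gset (S : gset R g) :=
  forall n, (0 < n)%N -> convex_set (S n).

Definition gcup t (S : 'I_t -> gset R g) : gset R g :=
  fun n => \bigcup_k S k n.

(* Intersecting with symtuple matters for the empty family only. *)
Definition gcap s (S : 'I_s -> gset R g) : gset R g :=
  fun n => @symtuple R g n `&` \bigcap_j S j n.

Definition pc (S : gset R g) : gset R g :=
  fun n => connected_component (S n) 0.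

Definition invset (p : sympoly R g) : gset R g :=
  fun n => [set X | symtuple X /\ mxeval p X \in unitmx].

Definition Dset (p : sympoly R g) : gset R g := pc (invset p).

Definition free_basic_open (S : gset R g) :=
  exists s (p : 'I_s -> sympoly R g), eq_gset S (gcap (fun j => Dset (p j))).

Definition free_open (S : gset R g) :=
  exists t (B : 'I_t -> gset R g),
    [/\ (0 < t)%N, forall k, free_basic_open (B k) & eq_gset S (gcup B)].

Definition inv_semialg (S : gset R g) :=
  exists t (s : 'I_t -> nat) (p : forall k, 'I_(s k) -> sympoly R g),
    (0 < t)%N /\ eq_gset S (gcup (fun k => gcap (fun j => invset (p k j)))).

Definition posdefmx n (M : 'M[R]_n) :=
  M^T = M /\ forall v : 'cV[R]_n, v != 0 -> 0 < (v^T *m M *m v) 0 0.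

Definition pencil_dom l (A : 'I_g -> 'M[R]_l) : gset R g :=
  fun n => [set Z | symtuple Z /\ posdefmx (mxeval (pencil A) Z)].

End GradedSets.

Definition tuple_cat (R : realType) g h n
    (X : 'I_g -> 'M[R]_n) (Y : 'I_h -> 'M[R]_n) : 'I_(g + h) -> 'M[R]_n :=
  fun i => match fintype.split i with inl j => X j | inr k => Y k end.

Definition fproj (R : realType) g h (D : gset R (g + h)) : gset R g :=
  fun n => [set X | symtuple X /\
    exists Y : 'I_h -> 'M[R]_n, symtuple Y /\ D n (tuple_cat X Y)].

(* Main.v *)
Require Import Defs.
From mathcomp Require Import all_boot all_order all_algebra finmap.
From mathcomp Require Import all_classical all_reals topology convex normedtype.
From mathcomp Require Import derive interval_inference.
From mathcomp Require Import -(notations) monalg.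
From mathcomp Require Import mxtens ring lra.

(* The projection K of the pencil [[1, x + z], [x + z, 1 + y]] (+) (1 + z) along
   z is, at level 1, the planar convex set 1 + y > max(x - 1, 0)^2.  For t > 1
   its boundary contains the points (t, t^2 - 2t) of a parabola through 0.  On
   this parabola every det p is a polynomial in t, nonzero at t = 0 when p(0)
   is invertible.  Hence, given finitely many p, all the p are invertible at
   some boundary point with t > 1, and also on a small vertical segment above
   it, all of whose other points lie in K.  This segment is connected, so a set
   described by the p that contains its upper end contains the whole segment,
   hence a boundary point of the open set K.
   The pencil domain D_L is free basic open because it is open, and because an
   invertible symmetric matrix that is not positive definite belongs to one of
   the open sets v^T M v < 0: D_L is thus relatively clopen in I_L. *)

Set Implicit Arguments.
Unset Strict Implicit.
Unset Printing Implicit Defensive.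

Import Order.TTheory GRing.Theory Num.Theory.
Import numFieldNormedType.Exports.
Import ArrowAsProduct.

Local Open Scope classical_set_scope.
Local Open Scope ring_scope.

(** * Evaluation of free polynomials at zero, along curves and on lines *)

Section PolynomialCurves.
Variables (R : realType) (g n : nat).

Definition curve_at (X : 'I_g -> 'M[{poly R}]_n) (t : R) : 'I_g -> 'M[R]_n :=
  fun j => map_mx (horner_eval t) (X j).

Lemma map_mx_hornerC m k (A : 'M[R]_(m, k)) t :
  map_mx (horner_eval t) (map_mx polyC A) = A.
Proof. by apply/matrixP=> i j; rewrite !mxE /horner_eval hornerC. Qed.

(** [horner_eval t] is a ring morphism, so it commutes with words, tensor products and determinants:
    [P] is the determinant computed over [{poly R}]. *)
Lemma det_mxeval_curve d (p : 'M[freepoly R g]_d) X :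
  exists P : {poly R}, forall t, \det (mxeval p (curve_at X t)) = P.[t].
Proof.
exists (\det (\sum_(w <- mxsupp p)
  map_mx polyC (mxcoef p w) *t \prod_(j <- (w : seq 'I_g)) X j)) => t.
rewrite -[RHS]/(horner_eval t _) -det_map_mx raddf_sum; congr (\det _).
apply: eq_bigr => w _; rewrite [RHS](map_mxT (horner_eval t)) map_mx_hornerC.
by congr (_ *t _); rewrite /word_eval rmorph_prod.
Qed.

Lemma mxcoef_eq0 d (p : 'M[freepoly R g]_d) w :
  w \notin mxsupp p -> mxcoef p w = 0.
Proof.
move=> nin; apply/matrixP => a b; rewrite !mxE; apply/mcoeff_outdom.
apply: contra nin => inab; rewrite /mxsupp.
apply/bigfcupP; exists a; rewrite ?mem_index_enum //.
by apply/bigfcupP; exists b; rewrite ?mem_index_enum.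
Qed.

(** Coefficients outside [mxsupp p] vanish, so any convenient list of words may replace the
    support. *)
Lemma mxeval_supp (s : seq (word g)) d (p : 'M[freepoly R g]_d)
    (X : 'I_g -> 'M[R]_n) : uniq s -> {subset mxsupp p <= s} ->
  mxeval p X = \sum_(w <- s) mxcoef p w *t word_eval w X.
Proof.
move=> us sub; rewrite (bigID (mem (mxsupp p))) /= [X in _ = _ + X]big1 ?addr0.
  rewrite -big_filter; apply: perm_big; apply: uniq_perm.
  - exact: fset_uniq.
  - exact: filter_uniq.
  - by move=> w; rewrite mem_filter; case: (boolP (w \in _)) => // /sub ->.
by move=> w nin; rewrite mxcoef_eq0 ?tens0mx.
Qed.

Lemma mxeval_zero d (p : 'M[freepoly R g]_d) :
  mxeval p (fun=> 0 : 'M[R]_n) = mxeval0 p *t (1 : 'M[R]_n).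
Proof.
rewrite (@mxeval_supp (undup (fmone 'I_g :: mxsupp p))) ?undup_uniq //;
  last by move=> w; rewrite mem_undup inE orbC => ->.
rewrite (bigD1_seq (fmone 'I_g)) ?undup_uniq ?mem_undup ?mem_head //=.
rewrite big1 ?addr0 => [|[[|j w]] nw].
- by rewrite /mxeval0 /word_eval /fmone fmE /= big_nil.
- by move: nw; rewrite /fmone fmE eqxx.
- by rewrite /word_eval /= big_cons mul0r tensmx0.
Qed.

Lemma unit_mxeval_zero (p : sympoly R g) :
  (0 < n)%N -> mxeval p (fun=> 0 : 'M[R]_n) \in unitmx.
Proof.
move=> n0; rewrite mxeval_zero tensmx_unit ?unitmx1 ?sp_unit0 //.
  by rewrite -lt0n sp_size_gt0.
by rewrite -lt0n.
Qed.

Lemma connected_line (X Y : 'I_g -> 'M[R]_n) (a b : R) :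
  connected [set (fun j => X j + t *: Y j) | t in `[a, b]].
Proof.
apply: connected_continuous_connected; first exact: segment_connected.
apply: continuous_subspaceT => t; apply/cvg_sup => j.
apply: (@continuous_comp_initial _ _ _ (fun f : 'I_g -> 'M[R]_n => f j)) => {}t.
apply: cvgD; first exact: cvg_cst.
exact: cvgZr_tmp cvg_id.
Qed.

Lemma coord_tuple_continuous j a b :
  continuous (fun Z : 'I_g -> 'M[R]_n => Z j a b).
Proof.
move=> Z; apply: (@continuous_comp _ _ _ (fun Z : 'I_g -> 'M[R]_n => Z j)
  (fun M : 'M[R]_n => M a b)).
  exact: (@proj_continuous _ (fun=> 'M[R]_n) j).
exact: coord_continuous.
Qed.

End PolynomialCurves.

(** * Finitely many invertibility conditions at level 1 *)

Section ControlledSets.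
Variable R : realType.

(** The points a + 1, ..., a + [size Q] outnumber the roots of [Q]. *)
Lemma poly_nonroot_gt (Q : {poly R}) (a : R) :
  Q != 0 -> exists2 t, a < t & Q.[t] != 0.
Proof.
move=> Q0; pose rs := [seq a + k.+1%:R | k <- iota 0 (size Q)].
have urs : uniq rs.
  rewrite map_inj_uniq ?iota_uniq // => k k' /addrI/eqP.
  by rewrite eqr_nat eqSS => /eqP.
have /allPn[_ /mapP[k _ ->] nr] : ~~ all (root Q) rs.
  apply/negP => /(max_poly_roots Q0)/(_ urs).
  by rewrite size_map size_iota ltnn.
by exists (a + k.+1%:R); rewrite ?ltrDl ?ltr0Sn.
Qed.

Lemma poly_nonroot_near0 (Q : {poly R}) :
  Q.[0] != 0 -> exists2 e, 0 < e & forall s, 0 <= s <= e -> Q.[s] != 0.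
Proof.
move=> Q0.
have /nbhs_ballP[d d0 dQ] : \forall s \near (0 : R), Q.[s] != 0.
  exact: cvgr_neq0 (@continuous_horner _ Q 0) Q0.
exists (d / 2) => [|s /andP[s0 sd]]; first exact: divr_gt0.
apply: dQ; rewrite /ball /= sub0r normrN ger0_norm //.
by move: d0 sd => /=; lra.
Qed.

(* For t > 1 and s = 0 this is a boundary arc of the projection at level 1; the
   parabola carrying it passes through 0 at t = 0. *)
Definition arc_point (t s : R) : 'I_2 -> 'M[R]_1 :=
  fun j => (if j == 0 then t else t ^+ 2 - 2 * t + s)%:M.

Definition arc_segment (t e : R) : set ('I_2 -> 'M[R]_1) :=
  [set arc_point t s | s in `[0, e]].

Lemma arc_point00 : arc_point 0 0 = fun=> 0.
Proof.
apply/funext => j; rewrite /arc_point; case: ifP => _; first exact: raddf0.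
by rewrite expr0n mulr0 subr0 addr0 raddf0.
Qed.

Lemma symtuple_size1 g (X : 'I_g -> 'M[R]_1) : symtuple X.
Proof. by move=> j; apply/matrixP => a b; rewrite mxE !ord1. Qed.

Lemma arc_segment_connected t e : connected (arc_segment t e).
Proof.
have := @connected_line R 2 1 (arc_point t 0) (fun j => (j != 0)%:R%:M) 0 e.
congr connected; rewrite eqEsubset; split=> _ [s sI <-]; exists s => //;
  apply/funext => j; rewrite /arc_point; case: eqVneq => _;
  by rewrite scale_scalar_mx -raddfD /= ?mulr0 ?mulr1 ?addr0.
Qed.

Lemma map_scalar_horner_eval (P : {poly R}) t :
  map_mx (horner_eval t) (P%:M : 'M_1) = (P.[t])%:M.
Proof. by rewrite map_scalar_mx. Qed.

Lemma det_mxeval_arc d (p : 'M[freepoly R 2]_d) :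
  exists P : {poly R}, forall t, \det (mxeval p (arc_point t 0)) = P.[t].
Proof.
have [P HP] := det_mxeval_curve p
  (fun j => (if j == 0 then 'X else 'X^2 - 2%:P * 'X)%:M : 'M[{poly R}]_1).
exists P => t; rewrite -HP; congr (\det (mxeval p _)); apply/funext => j.
rewrite /curve_at map_scalar_horner_eval /arc_point.
by case: eqP => _; rewrite !hornerE.
Qed.

Lemma det_mxeval_segment d (p : 'M[freepoly R 2]_d) t :
  exists P : {poly R}, forall s, \det (mxeval p (arc_point t s)) = P.[s].
Proof.
have [P HP] := det_mxeval_curve p
  (fun j => (if j == 0 then t%:P else (t ^+ 2 - 2 * t)%:P + 'X)%:M
     : 'M[{poly R}]_1).
exists P => s; rewrite -HP; congr (\det (mxeval p _)); apply/funext => j.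
rewrite /curve_at map_scalar_horner_eval /arc_point.
by case: eqP => _; rewrite !hornerE.
Qed.

Lemma arc_segment_invset (I : finType) (p : I -> sympoly R 2) :
  exists t e, [/\ 1 < t, 0 < e &
    forall i, arc_segment t e `<=` @invset R 2 (p i) 1].
Proof.
have [P HP] := choice (fun i => det_mxeval_arc (p i)).
(* The parabola passes through 0, where every [p i] is invertible, so no factor is the zero
   polynomial. *)
have /(poly_nonroot_gt 1)[t t1 Pt] : \prod_i P i != 0.
  apply/prodf_neq0 => i _; apply/eqP => Pi0.
  have := unit_mxeval_zero (p i) (ltn0Sn 0).
  by rewrite unitmxE unitfE -arc_point00 HP Pi0 horner0 eqxx.
(* On the vertical line through the chosen arc point, the product of the determinants is nonzero at
   s = 0, hence on a short interval. *)
have [Q HQ] := choice (fun i => det_mxeval_segment (p i) t).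
have /poly_nonroot_near0[e e0 Qe] : (\prod_i Q i).[0] != 0.
  by move: Pt; rewrite !horner_prod; under eq_bigr do rewrite -HP HQ.
exists t, e; split=> // i _ [s sI <-]; split; first exact: symtuple_size1.
have /Qe : 0 <= s <= e by move: sI; rewrite /= in_itv.
by rewrite horner_prod unitmxE unitfE HQ => /prodf_neq0/(_ i isT).
Qed.

(** Isolates what both forms of semi-algebraicity share: along a connected set, membership in [S] at
    level 1 can change only where some [p i] is singular. *)
Definition controlled (S : gset R 2) :=
  exists (I : finType) (p : I -> sympoly R 2), forall C : set ('I_2 -> 'M[R]_1),
    connected C -> (forall i, C `<=` @invset R 2 (p i) 1) ->
    C `&` S 1%N !=set0 -> C `<=` S 1%N.

Lemma controlled_arc_segment (S : gset R 2) : controlled S ->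
  exists t e, [/\ 1 < t, 0 < e, connected (arc_segment t e) &
    S 1%N (arc_point t e) -> arc_segment t e `<=` S 1%N].
Proof.
move=> [I [p cS]]; have [t [e [t1 e0 sub]]] := arc_segment_invset p.
have cC := @arc_segment_connected t e; exists t, e; split=> // Se.
apply: cS => //; exists (arc_point t e); split=> //.
by exists e; rewrite //= in_itv /= lexx ltW.
Qed.

(** A connected subset of [invset] stays in one component; if it meets [Dset], this is the component
    of 0. *)
Lemma free_open_controlled S : free_open S -> controlled S.
Proof.
move=> [m [B [_ /choice[s bB] SB]]].
(* The type of the k-th family depends on [s k], so it is extracted by [cid] once [s] is chosen. *)
pose p k := projT1 (cid (bB k)).
have BE k : eq_gset (B k) (gcap (fun j => Dset (p k j))).
  exact: projT2 (cid (bB k)).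
exists {k : 'I_m & 'I_(s k)}, (fun u => p (tag u) (tagged u)) => C cC sub.
rewrite (SB 1%N) // => -[z [Cz [k _ Bkz]]] x Cx; exists k => //.
move: Bkz; rewrite (BE k) // => -[_ Dz]; split.
  exact: symtuple_size1.
move=> j _; rewrite /Dset /pc (same_connected_component (Dz j I)).
apply: (connected_component_max Cz _ cC) => //.
exact: (sub (Tagged (fun k => 'I_(s k)) j)).
Qed.

(** All of [C] lies in every term of the union; the point of [C] in [S] supplies an index k. *)
Lemma inv_semialg_controlled S : inv_semialg S -> controlled S.
Proof.
move=> [m [s [p [_ SE]]]].
exists {k : 'I_m & 'I_(s k)}, (fun u => p (tag u) (tagged u)) => C cC sub.
rewrite (SE 1%N) // => -[z [Cz [k _ _]]] x Cx; exists k => //; split.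
  exact: symtuple_size1.
move=> j _; exact: (sub (Tagged (fun k => 'I_(s k)) j)).
Qed.

End ControlledSets.

(** * Coefficients, evaluation and symmetry of monic pencils *)

Section Pencils.
Variables (R : realType) (g l : nat).
Implicit Types (A : 'I_g -> 'M[R]_l).

Lemma fmuE (j : 'I_g) : fmu j = FMonom [:: j].
Proof. by rewrite /fmu fmE. Qed.

Lemma fmoneE : fmone 'I_g = FMonom [::].
Proof. by rewrite /fmone fmE. Qed.

Lemma fmu_inj : injective (@fmu 'I_g).
Proof. by move=> j k; rewrite !fmuE => -[]. Qed.

Lemma fmu_neq1 (j : 'I_g) : fmu j != fmone 'I_g.
Proof. by rewrite fmuE fmoneE. Qed.

Lemma mcoeff_fvar (c : R) (j : 'I_g) w :
  mcoeff w (c *: fvar R j) = (w == fmu j)%:R * c.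
Proof. by rewrite [LHS]mcoeffZ mcoeffU1 mulrC eq_sym. Qed.

Lemma mxcoef_pencil A w : mxcoef (pencil A) w =
  (w == fmone 'I_g)%:R *: 1%:M + \sum_j (w == fmu j)%:R *: A j.
Proof.
apply/matrixP => a b; rewrite !mxE !summxE mcoeffD raddf_sum; congr (_ + _).
  by rewrite raddfMn /= mcoeff1 mulr_natr.
by apply: eq_bigr => j _; rewrite !mxE /= mcoeff_fvar.
Qed.

Lemma mxeval0_pencil A : mxeval0 (pencil A) = 1%:M.
Proof.
rewrite /mxeval0 mxcoef_pencil eqxx scale1r big1 ?addr0 // => j _.
by rewrite eq_sym (negPf (fmu_neq1 j)) scale0r.
Qed.

Lemma mxcoef_pencil_fmu A j : mxcoef (pencil A) (fmu j) = A j.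
Proof.
rewrite mxcoef_pencil (negPf (fmu_neq1 j)) scale0r add0r.
rewrite (bigD1 j) //= eqxx scale1r big1 ?addr0 // => k kj.
by rewrite (inj_eq fmu_inj) eq_sym (negPf kj) scale0r.
Qed.

Lemma mxeval_pencil A n (Z : 'I_g -> 'M[R]_n) :
  mxeval (pencil A) Z = 1%:M *t 1%:M + \sum_j A j *t Z j.
Proof.
(* Only the empty word and the single letters can have a nonzero coefficient. *)
rewrite (@mxeval_supp _ _ _ (fmone 'I_g :: [seq fmu j | j <- enum 'I_g])).
- rewrite big_cons big_map big_enum /= -/(mxeval0 _) mxeval0_pencil.
  congr (_ *t _ + _); first by rewrite /word_eval fmoneE /= big_nil.
  apply: eq_bigr => j _; rewrite mxcoef_pencil_fmu; congr (_ *t _).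
  by rewrite /word_eval fmuE /= big_seq1.
- rewrite cons_uniq (map_inj_uniq fmu_inj) enum_uniq andbT.
  by apply/mapP => -[j _ /esym/eqP]; rewrite (negPf (fmu_neq1 j)).
move=> w; apply: contraTT; rewrite inE negb_or => /andP[w1 wj].
have cw0 : mxcoef (pencil A) w = 0.
  rewrite mxcoef_pencil (negPf w1) scale0r add0r big1 // => j _.
  case: eqP => [wE|_]; last by rewrite scale0r.
  by case/mapP: wj; exists j; rewrite ?mem_enum.
apply/negP => /bigfcupP[a _ /bigfcupP[b _]].
rewrite -mcoeff_neq0 => /eqP; apply.
by move/matrixP: cw0 => /(_ a b); rewrite !mxE.
Qed.

Lemma rev_wordK : involutive (@rev_word g).
Proof. by case=> w; rewrite /rev_word /= revK. Qed.

Lemma mcoeff_invol (f : freepoly R g) w :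
  mcoeff w (invol f) = mcoeff (rev_word w) f.
Proof.
rewrite /invol raddf_sum /=.
rewrite (eq_bigr (fun v => if v == rev_word w then mcoeff v f else 0));
  last first.
  move=> v _; rewrite mcoeffU -(inj_eq (inv_inj rev_wordK)) rev_wordK.
  by case: eqP; rewrite ?mulr1n ?mulr0n.
have [inw|nin] := boolP (rev_word w \in msupp f).
  rewrite (bigD1_seq _ inw (fset_uniq _)) /= eqxx big1 ?addr0 //.
  by move=> v /negPf ->.
rewrite big1_seq ?mcoeff_outdom // => v /andP[_ vin].
by case: eqP nin => // <-; rewrite vin.
Qed.

(** Words of length at most 1 are their own reversals, so the involution merely transposes the
    [A j]. *)
Lemma mxinvol_pencil A : (forall j, (A j)^T = A j) ->
  mxinvol (pencil A) = pencil A.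
Proof.
move=> sA; apply/matrixP => a b; apply/malgP => w.
transitivity (mxcoef (pencil A) (rev_word w) b a).
  by rewrite [RHS]mxE -mcoeff_invol; congr mcoeff; rewrite !mxE.
transitivity (mxcoef (pencil A) w a b); last by rewrite mxE.
have eq_rev v : (rev_word w == v) = (w == rev_word v).
  by rewrite -(inj_eq (inv_inj rev_wordK)) rev_wordK.
have rev_fmu (j : 'I_g) : rev_word (fmu j) = fmu j by rewrite fmuE.
have rev_1 : rev_word (fmone 'I_g) = fmone 'I_g by rewrite fmoneE.
rewrite !mxcoef_pencil eq_rev rev_1.
rewrite !mxE !summxE [b == a]eq_sym; congr (_ + _); apply: eq_bigr => j _.
by rewrite !mxE eq_rev rev_fmu -{1}sA mxE.
Qed.

End Pencils.

(** * Quadratic forms and positive definite matrices *)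

Section PositiveDefinite.
Variables (R : realType) (m : nat).
Implicit Types (M N : 'M[R]_m) (u v : 'cV[R]_m).

Definition dotv u v : R := (u^T *m v) 0 0.

Definition quad M v : R := (v^T *m M *m v) 0 0.

Definition mx_norm1 M : R := \sum_i \sum_j `|M i j|.

Lemma quadE M v : quad M v = \sum_i \sum_j M i j * (v i 0 * v j 0).
Proof.
rewrite /quad -mulmxA mxE; apply: eq_bigr => i _.
rewrite !mxE mulr_sumr; apply: eq_bigr => j _.
by ring.
Qed.

Lemma quadD M N v : quad (M + N) v = quad M v + quad N v.
Proof. by rewrite /quad mulmxDr mulmxDl mxE. Qed.

Lemma quadZ a M v : quad (a *: M) v = a * quad M v.
Proof. by rewrite /quad -scalemxAr -scalemxAl mxE. Qed.

Lemma dotvv v : dotv v v = \sum_i v i 0 ^+ 2.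
Proof. by rewrite /dotv mxE; apply: eq_bigr => i _; rewrite mxE. Qed.

Lemma dotvv_ge0 v : 0 <= dotv v v.
Proof. by rewrite dotvv; apply: sumr_ge0 => i _; exact: sqr_ge0. Qed.

Lemma dotvv_gt0 v : v != 0 -> 0 < dotv v v.
Proof.
apply: contraNT; rewrite lt0r dotvv_ge0 andbT negbK dotvv.
rewrite psumr_eq0 => [/allP v0|i _]; last exact: sqr_ge0.
apply/eqP/matrixP => i j; rewrite ord1 mxE; apply/eqP.
by rewrite -sqrf_eq0; exact: v0 (mem_index_enum i).
Qed.

Lemma norm_quad_le M v : `|quad M v| <= mx_norm1 M * dotv v v.
Proof.
rewrite quadE (le_trans (ler_norm_sum _ _ _)) // mulr_suml ler_sum // => i _.
rewrite (le_trans (ler_norm_sum _ _ _)) // mulr_suml ler_sum // => j _.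
rewrite normrM ler_wpM2l //.
have sqr_le k : v k 0 ^+ 2 <= dotv v v.
  rewrite dotvv (bigD1 k) //= lerDl sumr_ge0 // => *; exact: sqr_ge0.
have := sqr_le i; have := sqr_le j.
(* Expanding both squares gives 2|v_i v_j| <= v_i^2 + v_j^2 <= 2 [dotv v v]. *)
have := sqr_ge0 (v i 0 - v j 0); have := sqr_ge0 (v i 0 + v j 0).
rewrite ler_norml !sqrrD sqrrN !mulrN !mulr2n.
by move=> h1 h2 h3 h4; apply/andP; split; lra.
Qed.

(** The added 1 makes the constant positive for every [M], so that one may divide by it. *)
Lemma quad_le M v : quad M v <= (mx_norm1 M + 1) * dotv v v.
Proof.
rewrite (le_trans (ler_norm _)) // (le_trans (norm_quad_le _ _)) //.
by rewrite ler_wpM2r ?dotvv_ge0 // lerDl.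
Qed.

Lemma quad_subZ M u v t : M^T = M ->
  quad M (v - t *: u) = quad M v - 2 * t * dotv u (M *m v) + t ^+ 2 * quad M u.
Proof.
move=> sM.
have sym : (v^T *m M *m u) 0 0 = dotv u (M *m v).
  transitivity ((v^T *m M *m u)^T 0 0); first by rewrite [RHS]mxE.
  by rewrite !trmx_mul trmxK sM.
have -> : quad M (v - t *: u) = quad M v - t * (v^T *m M *m u) 0 0 -
    t * (u^T *m M *m v) 0 0 + t ^+ 2 * quad M u.
  rewrite /quad [(_ - _)^T]linearB /= [(_ *: _)^T]linearZ /= mulmxBr !mulmxBl.
  rewrite -!scalemxAl.
  by rewrite -!scalemxAr !mxE; ring.
by rewrite sym -mulmxA -/(dotv u _); ring.
Qed.

Lemma mx_norm1_ge0 M : 0 <= mx_norm1 M.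
Proof. by apply: sumr_ge0 => i _; apply: sumr_ge0. Qed.

Lemma posdef_unit M : posdefmx M -> M \in unitmx.
Proof.
move=> [sM pM]; rewrite -row_free_unit -kermx_eq0.
apply/rowV0P => v /sub_kermxP vM.
apply: contrapT => /eqP v0.
by have := pM v^T; rewrite trmx_eq0 v0 trmxK vM mul0mx mxE ltxx => /(_ isT).
Qed.

(** Bounds the second-order term in [quad_subZ], at t = 1/K, by half of the first-order term
    2d/K. *)
Lemma ler_sqrVM (K q d : R) : 0 < K -> q <= K * d -> K^-1 ^+ 2 * q <= d / K.
Proof.
move=> K0 /(ler_wpM2l (sqr_ge0 K^-1)); congr (_ <= _).
by field; rewrite gt_eqF.
Qed.

Lemma posdef_coercive M : posdefmx M ->
  exists2 c, 0 < c & forall v, c * dotv v v <= quad M v.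
Proof.
(* M is nonnegative at v - t M^-1 v, for t = 1/K with K above |M^-1|. *)
move=> PM; have [sM pM] := PM; have uM := posdef_unit PM.
set N := invmx M; pose K := mx_norm1 N + 1.
have K0 : 0 < K by rewrite ltr_wpDl ?mx_norm1_ge0.
have sN : N^T = N by rewrite /N trmx_inv sM.
exists K^-1 => [|v]; first by rewrite invr_gt0.
have : 0 <= quad M (v - K^-1 *: (N *m v)).
  have [->|/pM/ltW//] := eqVneq (v - K^-1 *: (N *m v)) 0.
  by rewrite /quad mulmx0 mxE.
rewrite quad_subZ //.
have -> : dotv (N *m v) (M *m v) = dotv v v.
  by rewrite /dotv trmx_mul sN -mulmxA mulKmx.
have -> : quad M (N *m v) = quad N v.
  by rewrite /quad trmx_mul sN !mulmxA mulmxKV.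
by have := ler_sqrVM K0 (quad_le N v); lra.
Qed.

Lemma posdef_near M : posdefmx M -> exists2 e, 0 < e & forall N, N^T = N ->
  (forall i j, `|N i j - M i j| < e) -> posdefmx N.
Proof.
move=> PM; have [c c0 cM] := posdef_coercive PM.
(* One more than the number of entries: m^2 terms of size c/k sum to strictly less than c, even for
   m = 0. *)
pose k : R := (m * m).+1%:R.
have k0 : 0 < k by rewrite ltr0Sn.
exists (c / k) => [|N sN NM]; first exact: divr_gt0.
split=> // v v0; rewrite -/(quad N v) -(subrK M N) addrC quadD.
have n1 : mx_norm1 (N - M) < c.
  apply: (@le_lt_trans _ _ (\sum_(i < m) \sum_(j < m) (c / k))).
    by do 2![apply: ler_sum => ? _]; rewrite !mxE ltW.
  rewrite !sumr_const !card_ord -mulrnA -mulr_natr -mulrA gtr_pMr //.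
  by rewrite mulrC ltr_pdivrMr // mul1r ltr_nat.
have := cM v; have := norm_quad_le (N - M) v; rewrite ler_norml => /andP[+ _].
have := dotvv_gt0 v0; rewrite -(ltr_pM2r (dotvv_gt0 v0)) in n1.
lra.
Qed.

Lemma unit_not_posdef M : M^T = M -> M \in unitmx -> ~ posdefmx M ->
  exists v, quad M v < 0.
Proof.
move=> sM uM nPM; apply: contrapT => nv.
have quad_ge0 v : 0 <= quad M v.
  by rewrite leNgt; apply/negP => qv; apply: nv; exists v.
apply: nPM; split=> // v v0; rewrite -/(quad M v) lt_def quad_ge0 andbT.
apply/eqP => qv.
pose K := mx_norm1 M + 1.
have K0 : 0 < K by rewrite ltr_wpDl ?mx_norm1_ge0.
(* A null vector v moves to a negative value in the direction - M v. *)
have Mv0 : M *m v != 0.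
  by apply: contraNneq v0 => Mv; rewrite -(mulKmx uM v) Mv mulmx0.
have := quad_ge0 (v - K^-1 *: (M *m v)); rewrite quad_subZ // qv.
have := dotvv_gt0 Mv0; set d := dotv _ _ => d0.
have := ler_sqrVM K0 (quad_le M (M *m v)); rewrite -/d.
by have := divr_gt0 d0 K0; lra.
Qed.

End PositiveDefinite.

(** * Continuity of real-valued functions and matrix entries *)

Section RealContinuity.
Variables (R : realType) (T : topologicalType).
Implicit Types f : T -> R.

Lemma continuous_sumr n (f : 'I_n -> T -> R) :
  (forall i, continuous (f i)) -> continuous (fun x => \sum_i f i x).
Proof.
by move=> cf; apply: continuous_big => // -[x y]; exact: add_continuous.
Qed.

Lemma continuous_addc c f : continuous f -> continuous (fun x => c + f x).
Proof. by move=> cf x; apply: cvgD; [exact: cvg_cst|exact: cf]. Qed.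

Lemma continuous_mulc c f : continuous f -> continuous (fun x => c * f x).
Proof. by move=> cf x; apply: cvgM; [exact: cvg_cst|exact: cf]. Qed.

Lemma near_entries m (F : T -> 'M[R]_m) z e :
  (forall a b, continuous (fun x => F x a b)) -> 0 < e ->
  \forall x \near z, forall a b, `|F x a b - F z a b| < e.
Proof.
move=> cF e0; apply: filter_forall => a; apply: filter_forall => b.
have := cF a b z => /cvgrPdist_lt/(_ e e0).
by apply: filterS => x; rewrite distrC.
Qed.

End RealContinuity.

(** * Pencil domains: convexity, and description as a principal component *)

Section PencilDomains.
Variables (R : realType) (g l : nat) (A : 'I_g -> 'M[R]_l).
Hypothesis symA : forall j, (A j)^T = A j.

Lemma tensmx11 (k n : nat) : (1%:M : 'M[R]_k) *t (1%:M : 'M[R]_n) = 1%:M.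
Proof.
apply/matrixP => a b; case: (mxtens_indexP a) => i i'.
case: (mxtens_indexP b) => j j'.
by rewrite tensmxE !mxE -natrM mulnb (can_eq (@mxtens_indexK _ _)) xpair_eqE.
Qed.

Lemma mxeval_pencil_sym n (Z : 'I_g -> 'M[R]_n) :
  symtuple Z -> (mxeval (pencil A) Z)^T = mxeval (pencil A) Z.
Proof.
move=> sZ; rewrite mxeval_pencil tensmx11 linearD /= tr_scalar_mx linear_sum.
by congr (_ + _); apply: eq_bigr => j _; rewrite /= trmx_tens symA sZ.
Qed.

(** The weights sum to 1, which preserves the constant term. *)
Lemma mxeval_pencil_conv n (Z1 Z2 : 'I_g -> 'M[R]_n) t :
  mxeval (pencil A) (fun j => t *: Z1 j + (1 - t) *: Z2 j) =
  t *: mxeval (pencil A) Z1 + (1 - t) *: mxeval (pencil A) Z2.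
Proof.
rewrite !mxeval_pencil !scalerDr addrACA -scalerDl [t + _]addrC subrK scale1r.
congr (_ + _); rewrite !scaler_sumr -big_split; apply: eq_bigr => j _ /=.
by apply/matrixP => a b; rewrite !mxE; ring.
Qed.

Lemma pencil_dom_conv n (Z1 Z2 : 'I_g -> 'M[R]_n) t : 0 <= t <= 1 ->
  pencil_dom A Z1 -> pencil_dom A Z2 ->
  pencil_dom A (fun j => t *: Z1 j + (1 - t) *: Z2 j).
Proof.
move=> /andP[t0 t1] [sZ1 [_ pZ1]] [sZ2 [_ pZ2]].
have sZ : symtuple (fun j => t *: Z1 j + (1 - t) *: Z2 j).
  by move=> j; rewrite linearD /= !linearZ /= sZ1 sZ2.
split=> //; split=> [|v v0]; first exact: mxeval_pencil_sym.
rewrite mxeval_pencil_conv -/(quad _ v) quadD !quadZ.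
have := pZ1 v v0; have := pZ2 v v0; rewrite -!/(quad _ v).
set q1 := quad _ v; set q2 := quad _ v => q10 q20.
(* At t = 0 strictness comes from [Z2], otherwise from [Z1]. *)
have [->|tn0] := eqVneq t 0; first by rewrite mul0r add0r subr0 mul1r.
apply: ltr_wpDr; first by rewrite mulr_ge0 ?subr_ge0 // ltW.
by rewrite mulr_gt0 // lt0r tn0.
Qed.

Lemma pencil_dom_convex : convex_gset (pencil_dom A).
Proof.
move=> n _ Z1 Z2 t; rewrite !inE => dZ1 dZ2.
apply: (@pencil_dom_conv n Z1 Z2 t%:num) => //.
by apply/andP; split; [exact: ge0|exact: le1].
Qed.

Lemma pencil_dom0 n : pencil_dom A (fun=> 0 : 'M[R]_n).
Proof.
split; first by move=> j; rewrite trmx0.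
rewrite mxeval_pencil tensmx11 big1 ?addr0 => [|j _]; last by rewrite tensmx0.
split=> [|v v0]; first exact: tr_scalar_mx.
by rewrite mulmx1; exact: dotvv_gt0.
Qed.

Lemma mxeval_pencil_continuous n a b :
  continuous (fun Z : 'I_g -> 'M[R]_n => mxeval (pencil A) Z a b).
Proof.
rewrite (_ : (fun _ => _) = fun Z : 'I_g -> 'M[R]_n => (1%:M *t 1%:M) a b +
    \sum_j (A j *t Z j) a b); last first.
  by apply/funext => Z; rewrite mxeval_pencil mxE summxE.
apply: continuous_addc; apply: continuous_sumr => j.
case: (mxtens_indexP a) => a1 a2; case: (mxtens_indexP b) => b1 b2.
rewrite (_ : (fun _ => _) = fun Z : 'I_g -> 'M[R]_n => A j a1 b1 * Z j a2 b2).
  by apply: continuous_mulc; exact: coord_tuple_continuous.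
by apply/funext => Z; rewrite tensmxE.
Qed.

Lemma quad_pencil_continuous n v :
  continuous (fun Z : 'I_g -> 'M[R]_n => quad (mxeval (pencil A) Z) v).
Proof.
rewrite (_ : (fun _ => _) = fun Z : 'I_g -> 'M[R]_n =>
    \sum_a \sum_b (v a 0 * v b 0) * mxeval (pencil A) Z a b).
  do 2![apply: continuous_sumr => ?]; apply: continuous_mulc.
  exact: mxeval_pencil_continuous.
apply/funext => Z; rewrite quadE.
by do 2![apply: eq_bigr => ? _]; rewrite mulrC.
Qed.

Hypothesis l0 : (0 < l)%N.

(** Kept transparent so that its matrix is convertible to [pencil A]. *)
Definition pencil_sympoly : sympoly R g.
Proof.
refine (@SymPoly R g l (pencil A) l0 (mxinvol_pencil symA) _).
by rewrite mxeval0_pencil unitmx1.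
Defined.

(** The topology is that of all matrix tuples, so openness is stated relative to the symmetric
    ones. *)
Lemma pencil_dom_near n (Z : 'I_g -> 'M[R]_n) : pencil_dom A Z ->
  \forall Z' \near Z, symtuple Z' -> pencil_dom A Z'.
Proof.
move=> [sZ pZ]; have [e e0 He] := posdef_near pZ.
have := near_entries Z (@mxeval_pencil_continuous n) e0.
apply: filterS => Z' close sZ'; split=> //; apply: He => //.
exact: mxeval_pencil_sym.
Qed.

Lemma Dset_pencil : eq_gset (Dset pencil_sympoly) (pencil_dom A).
Proof.
move=> n n0; rewrite eqEsubset; split; last first.
  (* By convexity the segment from 0 to [Z] stays in the domain, hence in [invset]. *)
  move=> Z dZ; pose f t j : 'M[R]_n := 0 + t *: Z j.
  have f1 : f 1 = Z by apply/funext => j; rewrite /f add0r scale1r.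
  have f0 : f 0 = fun=> 0 by apply/funext => j; rewrite /f add0r scale0r.
  apply: (@connected_component_max _ _ [set f t | t in `[0, 1]]).
  - by exists 0; rewrite //= in_itv /= lexx ler01.
  - move=> _ [t /= tI <-]; have [] : pencil_dom A (f t).
      rewrite (_ : f t = fun j => t *: Z j + (1 - t) *: 0).
        apply: pencil_dom_conv dZ (pencil_dom0 n).
        by move: tI; rewrite in_itv.
      by apply/funext => j; rewrite /f scaler0 addrC.
    by move=> sZ pZ; split=> //; exact: posdef_unit.
  - exact: connected_line.
  - by exists 1; rewrite //= in_itv /= lexx ler01.
set C := @Dset R g pencil_sympoly n.
have Csub : C `<=` @invset R g pencil_sympoly n.
  exact: connected_component_sub.
have cC : connected C by exact: component_connected.
have C0 : C (fun=> 0).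
  apply: connected_component_refl; split; first by move=> j; rewrite trmx0.
  exact: unit_mxeval_zero.
(* In the connected set [C], the trace of the domain is nonempty, relatively open and relatively
   closed. *)
suff CE : C `&` @pencil_dom R g l A n = C by rewrite -CE => Z [].
apply: cC.
- by exists (fun=> 0); split=> //; exact: pencil_dom0.
- exists (interior [set Z : 'I_g -> 'M[R]_n | symtuple Z -> pencil_dom A Z]).
    exact: open_interior.
  rewrite eqEsubset; split=> Z [CZ dZ]; split=> //.
    exact: pencil_dom_near.
  have [sZ _] := Csub _ CZ.
  exact: (interior_subset dZ).
exists (~` \bigcup_v
    [set Z : 'I_g -> 'M[R]_n | quad (mxeval (pencil A) Z) v < 0]).
  apply: open_closedC; apply: bigcup_open => v _.
  apply: (open_comp _ (@open_lt _ 0)) => Z _.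
  exact: quad_pencil_continuous.
rewrite eqEsubset; split=> Z [CZ dZ]; split=> //.
  move=> [v _ /= qv]; have [_ [_ /(_ v) pv]] := dZ.
  have v0 : v != 0.
    by apply: contraTneq qv => ->; rewrite /quad mulmx0 mxE ltxx.
  by have := lt_trans qv (pv v0); rewrite ltxx.
have [sZ uZ] := Csub _ CZ; split=> //; apply: contrapT => nP.
have [v qv] := unit_not_posdef (mxeval_pencil_sym sZ) uZ nP.
by apply: dZ; exists v.
Qed.

End PencilDomains.

(** * The parabola pencil and its projection at level 1 *)

Section ParabolaPencil.
Variable R : realType.

(* The pencil [[1, x + z, 0], [x + z, 1 + y, 0], [0, 0, 1 + z]]. *)
Definition parabola_mx (j : 'I_(2 + 1)) : 'M[R]_3 :=
  \matrix_(a, b) (match val j, val a, val b with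
    | 0, 0, 1 | 0, 1, 0 | 1, 1, 1 | 2, 0, 1 | 2, 1, 0 | 2, 2, 2 => 1
    | _, _, _ => 0 end)%N%:R.

Lemma tr_parabola_mx j : (parabola_mx j)^T = parabola_mx j.
Proof.
apply/matrixP => a b; rewrite !mxE.
by move: j a b => [[|[|[|j]]] ltj] [[|[|[|a]]] lta] [[|[|[|b]]] ltb].
Qed.

Lemma big_ord_mul1 l (F : 'I_(l * 1) -> R) :
  \sum_i F i = \sum_a F (mxtens_index (a, ord0)).
Proof.
rewrite (reindex (fun a => mxtens_index (a, ord0))) //.
exists (fun i => (mxtens_unindex i).1) => [a _|i _].
  by rewrite mxtens_indexK.
by case: (mxtens_indexP i) => a b; rewrite mxtens_indexK ord1.
Qed.

Lemma quad_pencil_size1 g l (A : 'I_g -> 'M[R]_l) (Z : 'I_g -> 'M[R]_1) v :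
  quad (mxeval (pencil A) Z) v =
    \sum_a \sum_b ((a == b)%:R + \sum_j A j a b * Z j 0 0) *
      (v (mxtens_index (a, ord0)) 0 * v (mxtens_index (b, ord0)) 0).
Proof.
rewrite quadE mxeval_pencil tensmx11 big_ord_mul1; apply: eq_bigr => a _.
rewrite big_ord_mul1; apply: eq_bigr => b _; congr (_ * _).
rewrite mxE summxE mxE (can_eq (@mxtens_indexK _ _)) xpair_eqE eqxx andbT.
by congr (_ + _); apply: eq_bigr => j _; rewrite tensmxE.
Qed.

Let ix (a : 'I_3) : 'I_(3 * 1) := mxtens_index (a, ord0).

(** Completing the square with the corner entry 1 leaves the Schur complement 1 + y - (x + z)^2 and
    the block 1 + z as the two positivity conditions. *)
Lemma quad_parabola (X : 'I_2 -> 'M[R]_1) (Y : 'I_1 -> 'M[R]_1)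
    (v : 'cV[R]_(3 * 1)) (x := X 0 0 0) (y := X 1 0 0) (z := Y 0 0 0)
    (v0 := v (ix 0) 0) (v1 := v (ix 1) 0) (v2 := v (ix 2%:R) 0) :
  quad (mxeval (pencil parabola_mx) (tuple_cat X Y)) v =
    (v0 + (x + z) * v1) ^+ 2 + (1 + y - (x + z) ^+ 2) * v1 ^+ 2 +
    (1 + z) * v2 ^+ 2.
Proof.
have catl j : tuple_cat X Y (lshift 1 j) = X j.
  by rewrite /tuple_cat -[lshift _ _]/(unsplit (inl j)) unsplitK.
have catr j : tuple_cat X Y (rshift 2 j) = Y j.
  by rewrite /tuple_cat -[rshift _ _]/(unsplit (inr j)) unsplitK.
have entry a b : \sum_j parabola_mx j a b * tuple_cat X Y j 0 0 =
    parabola_mx (lshift 1 0) a b * x + parabola_mx (lshift 1 1) a b * y +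
    parabola_mx (rshift 2 0) a b * z.
  rewrite big_split_ord /= !big_ord_recl !big_ord0 !addr0 catr !catl.
  by rewrite (_ : lift ord0 ord0 = 1); last exact: val_inj.
rewrite quad_pencil_size1; under eq_bigr do under eq_bigr do rewrite entry.
rewrite !big_ord_recl !big_ord0 !mxE /=.
have -> : lift ord0 (lift ord0 ord0) = 2%:R :> 'I_3 by exact: val_inj.
have -> : lift ord0 ord0 = 1 :> 'I_3 by exact: val_inj.
rewrite -/(ix 0) -/(ix 1) -/(ix 2%:R) -/v0 -/v1 -/v2.
ring.
Qed.

Lemma parabola_proj_arc t s : 1 < t -> 0 < s ->
  fproj (pencil_dom parabola_mx) (arc_point t s).
Proof.
move=> t1 s0; split; first exact: symtuple_size1.
(* With z = d - 1, the Schur complement is s - 2(t - 1)d - d^2, which equals d(1 + s - d) since dD =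
   s; it is positive because 0 < d < 1. *)
pose D := 2 * t - 1 + s; pose d := s / D.
have D0 : 0 < D by rewrite /D; lra.
have d0 : 0 < d by exact: divr_gt0.
have d1 : d < 1 by rewrite ltr_pdivrMr // mul1r /D; lra.
have dD : d * D = s by rewrite divfK // gt_eqF.
exists (fun=> (d - 1)%:M); split; first exact: symtuple_size1.
split; first exact: symtuple_size1.
split=> [|v v0]; first exact/mxeval_pencil_sym/symtuple_size1/tr_parabola_mx.
rewrite -/(quad _ v) quad_parabola /arc_point !mxE /= !mulr1n.
set x := v _ _; set y := v _ _; set z := v _ _.
have gap : 0 < 1 + (t ^+ 2 - 2 * t + s) - (t + (d - 1)) ^+ 2.
  rewrite /D in dD; nra.
have : (x != 0) || (y != 0) || (z != 0).
  apply: contraNT v0; rewrite !negb_or !negbK => /andP[/andP[/eqP x0 /eqP y0]].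
  move=> /eqP z0; apply/eqP/matrixP => i j; rewrite [j]ord1 mxE.
  case: (mxtens_indexP i) => a b; rewrite [b]ord1.
  case: a => -[|[|[|a]]] lta //.
  - by rewrite -[RHS]x0 /x; congr (v (mxtens_index (_, _)) _); exact: val_inj.
  - by rewrite -[RHS]y0 /y; congr (v (mxtens_index (_, _)) _); exact: val_inj.
  - by rewrite -[RHS]z0 /z; congr (v (mxtens_index (_, _)) _); exact: val_inj.
set u := t + (d - 1) in gap *; set k := _ - _ in gap *.
have [->|y0] := eqVneq y 0; last first.
  move=> _; apply: ltr_wpDr; first by rewrite mulr_ge0 ?sqr_ge0 //; lra.
  apply: ltr_wpDl; first exact: sqr_ge0.
  by rewrite mulr_gt0 // exprn_even_gt0.
rewrite mulr0 addr0 expr0n mulr0 addr0 orbF => /orP[x0|z0].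
  apply: ltr_wpDr; first by rewrite mulr_ge0 ?sqr_ge0 //; lra.
  by rewrite exprn_even_gt0.
apply: ltr_wpDl; first exact: sqr_ge0.
by rewrite mulr_gt0 ?exprn_even_gt0 //; lra.
Qed.

Lemma parabola_not_proj_arc t : 1 < t ->
  ~ fproj (pencil_dom parabola_mx) (arc_point t 0).
Proof.
move=> t1 [_ [Y [_ [_ [_ pos]]]]]; pose z := Y 0 0 0.
pose vec (w : 'I_3 -> R) : 'cV[R]_(3 * 1) := \col_i w (mxtens_unindex i).1.
have vecE w a : vec w (ix a) 0 = w a by rewrite mxE mxtens_indexK.
have quad_vec w a : w a != 0 ->
    0 < quad (mxeval (pencil parabola_mx) (tuple_cat (arc_point t 0) Y))
          (vec w).
  move=> wa; apply: pos; apply: contraNneq wa => w0.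
  by rewrite -vecE w0 mxE.
(* The third basis vector yields 1 + z > 0. *)
have := quad_vec (fun a => if a == 2%:R then 1 else 0) 2%:R.
rewrite quad_parabola !vecE /= oner_eq0 => /(_ isT).
(* This vector annihilates the completed square and yields (t - 1)^2 > (t + z)^2, contradicting t +
   z > t - 1 > 0. *)
have := quad_vec
  (fun a => if a == 0 then - (t + z) else if a == 1 then 1 else 0) 1.
rewrite quad_parabola !vecE /= oner_eq0 => /(_ isT).
rewrite /arc_point !mxE /= !mulr1n -/z.
nra.
Qed.

End ParabolaPencil.

(** * Failure of semi-algebraicity for the projection *)

Theorem proposition9p8 (R : realType) :
  (exists (g h l : nat) (A : 'I_(g + h) -> 'M[R]_l),
     [/\ (0 < g)%N, (0 < h)%N, (0 < l)%N & forall j, trmx (A j) = A j] /\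
     (~ exists S : gset R g,
          free_open S /\ eq_gset (fproj (pencil_dom A)) (pc S)) /\
     (~ exists S : gset R g,
          inv_semialg S /\ eq_gset (fproj (pencil_dom A)) (pc S))) /\
  (exists (g h : nat) (D : gset R (g + h)),
     [/\ (0 < g)%N, (0 < h)%N, convex_gset D, free_basic_open D &
         ~ free_open (fproj D)]).
Proof.
have not_pc (S : gset R 2) : controlled S ->
    ~ eq_gset (fproj (pencil_dom (@parabola_mx R))) (pc S).
  move=> /controlled_arc_segment[t [e [t1 e0 cC sub]]] /(_ 1%N isT) KE.
  apply: (@parabola_not_proj_arc R t t1); rewrite KE.
  have Ce : pc S (arc_point t e) by rewrite -KE; exact: parabola_proj_arc.
  (* The component of 0 is also that of the upper end, so it absorbs the whole segment once this
     lies in [S]. *)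
  move: (Ce); rewrite /pc => /same_connected_component ->.
  apply: (@connected_component_max _ _ (arc_segment t e)) => //.
  - by exists e; rewrite //= in_itv /= lexx ltW.
  - by apply: sub; exact: (connected_component_sub Ce).
  - by exists 0; rewrite //= in_itv /= lexx ltW.
split.
  exists 2, 1, 3, (@parabola_mx R); split.
    by split=> //; exact: tr_parabola_mx.
  split=> -[S [cS]]; apply: not_pc.
    exact: free_open_controlled.
  exact: inv_semialg_controlled.
exists 2, 1, (pencil_dom (@parabola_mx R)); split=> //.
- exact/pencil_dom_convex/tr_parabola_mx.
- exists 1, (fun=> pencil_sympoly (@tr_parabola_mx R) (isT : 0 < 3)%N) => n n0.
  rewrite eqEsubset; split=> [Z dZ|Z [_ /(_ ord0 I)]].
    by have [sZ _] := dZ; split=> // j _; rewrite Dset_pencil.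
  by rewrite Dset_pencil.
(* Here the projection itself is controlled, so it contains the foot of the segment directly. *)
move=> /free_open_controlled/controlled_arc_segment[t [e [t1 e0 _ sub]]].
apply: (@parabola_not_proj_arc R t t1).
apply: sub; first exact: parabola_proj_arc.
by exists 0; rewrite //= in_itv /= lexx ltW.
Qed.
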